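(* Let $\lambda\in\mathbb{R}$ and let $f(x)\in\mathbb{C}[[x]]$ be a formal power series. For all integers $m,r\ge 0$, $$(xD)_{m,\lambda}\,x^{r}f(x)=\sum_{l=0}^{m}{m+r \brace l+r}_{r,\lambda}x^{l+r}D^{l}f(x).$$ In addition, for all integers $m,r$ with $m\ge r\ge 0$, $$(xD)_{m-r,\lambda}\,x^{r}D^{r}f(x)=\sum_{l=r}^{m}{m \brace l}_{r,\lambda}x^{l}D^{l}f(x).$$
   Context: $D=\frac{d}{dx}$ acts on formal power series $\mathbb{C}[[x]]$, and $x$ acts by multiplication; products of operators are compositions, so $(xD)_{m,\lambda}x^{r}f(x)$ means $(xD)_{m,\lambda}$ applied to $x^{r}f(x)$, and $(xD)_{m-r,\lambda}x^rD^rf(x)$ means $(xD)_{m-r,\lambda}$ applied to $x^rD^rf(x)$. For $\lambda\in\mathbb{R}$ and $y$ a number, indeterminate or operator, $(y)_{0,\lambda}=1$ and $(y)_{n,\lambda}=y(y-\lambda)(y-2\lambda)\cdots(y-(n-1)\lambda)$ for $n\ge 1$. Also $(y)_{0}=1$ and $(y)_{n}=y(y-1)\cdots(y-n+1)$ for $n\ge1$. For an integer $r\ge 0$, the degenerate $r$-Stirling numbers of the second kind ${n+r \brace k+r}_{r,\lambda}$ ($0\le k\le n$) are defined by the polynomial identity $$(y+r)_{n,\lambda}=\sum_{k=0}^{n}{n+r \brace k+r}_{r,\lambda}(y)_{k}\quad (n\ge 0).$$ In particular, for $m\ge l\ge r$, ${m\brace l}_{r,\lambda}$ means ${(m-r)+r\brace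 (l-r)+r}_{r,\lambda}$. *)

(* Defs.v *)
From HB Require Import structures.
From mathcomp Require Import all_boot all_order all_algebra.
From mathcomp Require Import boolp reals complex.

Set Implicit Arguments.
Unset Strict Implicit.
Unset Printing Implicit Defensive.

Import GRing.Theory.
Local Open Scope ring_scope.

(* The formal power series \sum_n f_n x^n is represented by its coefficient
   sequence n |-> f_n.  The multiplication is the Cauchy product, not the
   pointwise product of functions. *)
Definition fps (K : Type) : Type := nat -> K.

HB.instance Definition _ (K : choiceType) := Choice.copy (fps K) (nat -> K).

Section FpsRing.
Variable K : comNzRingType.
Implicit Types f g h : fps K.

Definition fps_add f g : fps K := fun n => f n + g n.
Definition fps_opp f : fps K := fun n => - f n.
Definition fps_one : fps K := fun n => (n == 0)%:R.
Definition fps_mul f g : fps K := fun n => \sum_(j < n.+1) f j * g (n - j)%N.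
Definition fps_scale (a : K) f : fps K := fun n => a * f n.

Fact fps_addA : associative fps_add.
Proof. by move=> f g h; apply/funext => n; rewrite /fps_add addrA. Qed.
Fact fps_addC : commutative fps_add.
Proof. by move=> f g; apply/funext => n; rewrite /fps_add addrC. Qed.
Fact fps_add0 : left_id (fun=> 0) fps_add.
Proof. by move=> f; apply/funext => n; rewrite /fps_add add0r. Qed.
Fact fps_addN : left_inverse (fun=> 0) fps_opp fps_add.
Proof. by move=> f; apply/funext => n; rewrite /fps_add /fps_opp addNr. Qed.

HB.instance Definition _ :=
  GRing.isZmodule.Build (fps K) fps_addA fps_addC fps_add0 fps_addN.

Let trunc N f : {poly K} := \poly_(i < N) f i.

Let truncM N f g n : (n < N)%N -> fps_mul f g n = (trunc N f * trunc N g)`_n.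
Proof.
move=> nN; rewrite coefM; apply: eq_bigr => j _; rewrite !coef_poly.
have -> : (j < N)%N := leq_ltn_trans (ltn_ord j : (j <= n)%N) nN.
by have -> : (n - j < N)%N := leq_ltn_trans (leq_subr j n) nN.
Qed.

Fact fps_mulA : associative fps_mul.
Proof.
move=> f g h; apply/funext => n.
have lt_n (j : 'I_n.+1) : (n - j < n.+1)%N by rewrite ltnS leq_subr.
transitivity (trunc n.+1 f * (trunc n.+1 g * trunc n.+1 h))`_n.
  rewrite coefM; apply: eq_bigr => j _.
  by rewrite (truncM _ _ (lt_n j)) coef_poly ltn_ord.
rewrite mulrA coefM; apply: eq_bigr => j _.
by rewrite (truncM _ _ (ltn_ord j)) coef_poly lt_n.
Qed.

Fact fps_mulC : commutative fps_mul.
Proof.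
by move=> f g; apply/funext => n; rewrite !(truncM _ _ (ltnSn n)) mulrC.
Qed.

Fact fps_mul1 : left_id fps_one fps_mul.
Proof.
move=> f; apply/funext => n.
by rewrite /fps_mul big_ord_recl subn0 mul1r big1 ?addr0 // => j _; rewrite mul0r.
Qed.

Fact fps_mulDl : left_distributive fps_mul fps_add.
Proof.
move=> f g h; apply/funext => n; rewrite /fps_mul /fps_add -big_split.
by apply: eq_bigr => j _; rewrite mulrDl.
Qed.

Fact fps_one_neq0 : fps_one != 0.
Proof. by apply/eqP => /(congr1 (@^~ 0%N)) /eqP; rewrite oner_eq0. Qed.

HB.instance Definition _ := GRing.Zmodule_isComNzRing.Build (fps K)
  fps_mulA fps_mulC fps_mul1 fps_mulDl fps_one_neq0.

Fact fps_scaleA a b f : fps_scale a (fps_scale b f) = fps_scale (a * b) f.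
Proof. by apply/funext => n; rewrite /fps_scale mulrA. Qed.
Fact fps_scale1 : left_id 1 fps_scale.
Proof. by move=> f; apply/funext => n; rewrite /fps_scale mul1r. Qed.
Fact fps_scaleDr : right_distributive fps_scale +%R.
Proof. by move=> a f g; apply/funext => n; rewrite /fps_scale [LHS]mulrDr. Qed.
Fact fps_scaleDl f : {morph fps_scale^~ f : a b / a + b}.
Proof. by move=> a b; apply/funext => n; rewrite /fps_scale [LHS]mulrDl. Qed.

HB.instance Definition _ := GRing.Zmodule_isLmodule.Build K (fps K)
  fps_scaleA fps_scale1 fps_scaleDr fps_scaleDl.

Fact fps_scaleAl (a : K) f g : a *: (f * g) = (a *: f) * g.
Proof.
apply/funext => n; rewrite [LHS]mulr_sumr.
by apply: eq_bigr => j _; rewrite mulrA.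
Qed.

HB.instance Definition _ := GRing.Lmodule_isLalgebra.Build K (fps K) fps_scaleAl.
HB.instance Definition _ := GRing.Lalgebra_isComAlgebra.Build K (fps K).

Definition fpsX : fps K := fun n => (n == 1)%:R.

Definition fpsD f : fps K := fun n => f n.+1 *+ n.+1.

Definition xD f : fps K := fpsX * fpsD f.

(* (T)_{n,lam} for an operator T: products of operators are compositions, and
   the scalar lam is read as the operator lam *: _. *)
Definition op_dfall (T : fps K -> fps K) (lam : K) (n : nat) : fps K -> fps K :=
  \big[comp/id]_(i < n) (fun f => T f - (lam *+ i) *: f).

End FpsRing.

Arguments fpsX {K}.

Section Falling.
Variable A : pzRingType.

Definition dfall (y lam : A) (n : nat) : A := \prod_(i < n) (y - lam *+ i).

Definition ffall (y : A) (n : nat) : A := \prod_(i < n) (y - i%:R).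

End Falling.

Section RStirling.
Variable K : comNzRingType.

Lemma ffallX_monic k : ffall ('X : {poly K}) k \is monic.
Proof. by apply: monic_prod => i _; rewrite -polyC_natr monicXsubC. Qed.

Lemma size_ffallX k : size (ffall ('X : {poly K}) k) = k.+1.
Proof.
rewrite /ffall; under eq_bigr do rewrite -polyC_natr.
by rewrite (size_prod_XsubC _ (fun i : 'I_k => i%:R)) /index_enum -enumT size_enum_ord.
Qed.

Lemma size_dfallX (r : nat) (lam : K) n :
  (size (dfall ('X + r%:R) lam%:P n) <= n.+1)%N.
Proof.
elim: n => [|n IHn]; first by rewrite /dfall big_ord0 size_poly1.
rewrite /dfall big_ord_recr /=; apply: leq_trans (size_polyMleq _ _) _.
have -> : 'X + r%:R - lam%:P *+ n = 'X + (r%:R - lam *+ n)%:P :> {poly K}.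
  by rewrite polyCB !polyCMn addrA.
by rewrite size_XaddC addn2.
Qed.

Lemma ffallX_expansion n (p : {poly K}) : (size p <= n)%N ->
  exists c : nat -> K, p = \sum_(k < n) c k *: ffall 'X k.
Proof.
elim: n p => [|n IHn] p sp.
  exists (fun=> 0); rewrite big_ord0; apply/eqP.
  by rewrite -size_poly_leq0.
have [|c Ec] := IHn (p - p`_n *: ffall 'X n).
  apply/leq_sizeP => j; rewrite leq_eqVlt coefB coefZ => /predU1P[<-|ltnj].
    have /monicP := ffallX_monic n.
    by rewrite lead_coefE size_ffallX => ->; rewrite mulr1 subrr.
  have -> : p`_j = 0 by rewrite nth_default // (leq_trans sp).
  have -> : (ffall ('X : {poly K}) n)`_j = 0 by rewrite nth_default ?size_ffallX.
  by rewrite mulr0 subrr.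
exists (fun k => if k == n then p`_n else c k).
rewrite big_ord_recr /= eqxx -[LHS](subrK (p`_n *: ffall 'X n)) Ec.
by congr (_ + _); apply: eq_bigr => i _; rewrite ltn_eqF.
Qed.

Lemma ffallX_free n (c d : nat -> K) :
  \sum_(k < n) c k *: ffall ('X : {poly K}) k = \sum_(k < n) d k *: ffall 'X k ->
  forall k, (k < n)%N -> c k = d k.
Proof.
elim: n => // n IHn E.
have small (e : nat -> K) :
    (\sum_(k < n) e k *: ffall ('X : {poly K}) k)`_n = 0.
  rewrite coef_sum big1 // => k _; rewrite coefZ.
  by rewrite nth_default ?mulr0 // size_ffallX.
have top : (ffall ('X : {poly K}) n)`_n = 1.
  by have /monicP := ffallX_monic n; rewrite lead_coefE size_ffallX.
have En : c n = d n.
  move/(congr1 (fun p : {poly K} => p`_n)): E.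
  by rewrite !big_ord_recr /= !coefD !small !coefZ top !add0r !mulr1.
move: E; rewrite !big_ord_recr /= En => /addIr /IHn Elt k.
by rewrite ltnS leq_eqVlt => /predU1P[->|/Elt].
Qed.

Lemma rstirling2_exists (r : nat) (lam : K) : exists S : nat -> nat -> K,
  forall n, dfall ('X + r%:R) lam%:P n = \sum_(k < n.+1) S n k *: ffall 'X k.
Proof.
have E n : exists c : nat -> K,
    dfall ('X + r%:R) lam%:P n = \sum_(k < n.+1) c k *: ffall 'X k.
  exact/ffallX_expansion/size_dfallX.
by have [S SP] := choice E; exists S.
Qed.

(* The degenerate r-Stirling number of the second kind with upper index m and
   lower index l, meaningful for r <= l <= m: the coefficients of the defining
   identity in y (here 'X), which rstirling2_unique shows to be determined by
   that identity. *)
Definition rstirling2 (r : nat) (lam : K) (m l : nat) : K :=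
  projT1 (cid (rstirling2_exists r lam)) (m - r)%N (l - r)%N.

Lemma rstirling2P (r : nat) (lam : K) n :
  dfall ('X + r%:R) lam%:P n =
  \sum_(k < n.+1) rstirling2 r lam (n + r) (k + r) *: ffall 'X k.
Proof.
rewrite (projT2 (cid (rstirling2_exists r lam)) n).
by apply: eq_bigr => k _; rewrite /rstirling2 !addnK.
Qed.

Lemma rstirling2_unique (r : nat) (lam : K) n (c : nat -> K) :
  dfall ('X + r%:R) lam%:P n = \sum_(k < n.+1) c k *: ffall 'X k ->
  forall k, (k <= n)%N -> c k = rstirling2 r lam (n + r) (k + r).
Proof.
rewrite rstirling2P => /esym E k kn.
exact: (ffallX_free (d := fun k => rstirling2 r lam (n + r) (k + r)) E).
Qed.

End RStirling.

(* Main.v *)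
(* On coefficient sequences [xD] is diagonal: it multiplies the n-th coefficient
   by n.  Hence [(xD)_{m,lam}] and [x^l D^l] multiply it by [(n)_{m,lam}] and
   [(n)_l].  Comparing coefficients of [x^(k+r)] thus reduces the first identity
   to the defining identity of the r-Stirling numbers at [y = k]; the second one
   is the first one for [m - r] and [D^r f]. *)
Require Import Defs.
From mathcomp Require Import all_boot all_order all_algebra.
From mathcomp Require Import boolp reals complex.

Import GRing.Theory.
Local Open Scope ring_scope.
Local Open Scope complex_scope.

Section FpsCoefficients.
Context {K : comNzRingType}.
Implicit Types f g : fps K.

Lemma fpsBE f g n : (f - g) n = f n - g n. Proof. by []. Qed.

Lemma fpsZE (a : K) f n : (a *: f) n = a * f n. Proof. by []. Qed.

Lemma fpsME f g n : (f * g) n = \sum_(j < n.+1) f j * g (n - j)%N.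
Proof. by []. Qed.

Lemma fps_sumE I (s : seq I) (F : I -> fps K) n :
  (\sum_(i <- s) F i) n = \sum_(i <- s) F i n.
Proof. by elim/big_rec2: _ => // i x y _ <-. Qed.

Lemma fpsXME f n : (fpsX * f) n = if n is p.+1 then f p else 0.
Proof.
rewrite fpsME big_ord_recl mul0r add0r.
case: n => [|n]; first by rewrite big_ord0.
by rewrite big_ord_recl mul1r subSS subn0 big1 ?addr0 // => i _; rewrite mul0r.
Qed.

Lemma fpsXnME f r n :
  (fpsX ^+ r * f) n = if (n < r)%N then 0 else f (n - r)%N.
Proof.
elim: r n => [|r IHr] n; first by rewrite mul1r subn0.
by rewrite exprS -mulrA fpsXME; case: n.
Qed.

Lemma xD_coef f n : xD f n = n%:R * f n.
Proof. by rewrite /xD fpsXME; case: n => [|n]; rewrite ?mul0r // mulr_natl. Qed.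

(** Each factor of the composition is diagonal, with eigenvalue [n%:R - lam *+ i] on the [n]-th
    coefficient, so the eigenvalues multiply. *)
Lemma op_dfall_xD_coef (lam : K) m f n :
  op_dfall (@xD K) lam m f n = dfall n%:R lam m * f n.
Proof.
rewrite /op_dfall /dfall; elim/big_rec2: _ f => [|i y T _ IH] f.
  by rewrite mul1r.
by rewrite /= fpsBE fpsZE xD_coef IH -mulrBl mulrA.
Qed.

(** Since [x^(l+1) D^(l+1) = x^l (xD) D^l] and [x^l] shifts coefficients by [l], each induction step
    contributes the factor [n - l]. *)
Lemma fpsXn_iterD_coef l f n :
  (fpsX ^+ l * iter l (@fpsD K) f) n = ffall n%:R l * f n.
Proof.
elim: l => [|l IHl]; first by rewrite mul1r /ffall big_ord0 mul1r.
rewrite /ffall big_ord_recr /= -/(ffall _ l) mulrAC -IHl exprSr -mulrA.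
rewrite -/(xD _) !fpsXnME xD_coef.
(* For [n < l] both sides are zero; otherwise truncated subtraction agrees with that of [K]. *)
by case: ltnP => [_|le_ln]; rewrite ?mul0r // natrB // mulrC.
Qed.

End FpsCoefficients.

(** Evaluation at [k%:R] is a ring morphism, so it passes through the products and the sum in
    [rstirling2P]. *)
Lemma rstirling2_nat (K : comNzRingType) (r : nat) (lam : K) m k :
  dfall (k + r)%:R lam m =
  \sum_(l < m.+1) rstirling2 r lam (m + r) (l + r) * ffall k%:R l.
Proof.
have /(congr1 (horner^~ k%:R)) := rstirling2P r lam m.
rewrite /dfall horner_prod horner_sum natrD => E; transitivity (\prod_(i < m)
  ('X + r%:R - lam%:P *+ i).[k%:R]).
  by apply: eq_bigr => i _; rewrite -polyC_natr !hornerE hornerMn hornerC.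
rewrite E; apply: eq_bigr => l _; rewrite hornerZ /ffall horner_prod.
by congr (_ * _); apply: eq_bigr => i _; rewrite -polyC_natr !hornerE.
Qed.

Lemma op_dfall_xD_fpsXnM (K : comNzRingType) (lam : K) (f : fps K) m r :
  op_dfall (@xD K) lam m (fpsX ^+ r * f) =
  \sum_(0 <= l < m.+1) rstirling2 r lam (m + r) (l + r)
     *: (fpsX ^+ (l + r) * iter l (@fpsD K) f).
Proof.
apply/funext => n; rewrite op_dfall_xD_coef fps_sumE big_mkord.
(* With [x^(l+r)] split as [x^r x^l], each summand is the diagonal operator [x^l D^l] read at index
   [n - r]. *)
under eq_bigr => l _ do
  rewrite fpsZE [in fpsX ^+ _]addnC exprD -mulrA fpsXnME fpsXn_iterD_coef.
rewrite fpsXnME; case: ltnP => [_|le_rn].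
  by rewrite mulr0 big1 // => l _; rewrite mulr0.
(* Only the argument of [dfall] is rewritten as [(n - r) + r], so that the identity applies at
   [k = n - r]. *)
rewrite -{1}(subnK le_rn) rstirling2_nat mulr_suml.
by apply: eq_bigr => l _; rewrite mulrA.
Qed.

Theorem theorem1 (R : realType) (lam : R) (f : fps R[i]) :
  (forall m r : nat,
     op_dfall (@xD R[i]) lam%:C m (fpsX ^+ r * f) =
     \sum_(0 <= l < m.+1)
        rstirling2 r lam%:C (m + r) (l + r)
          *: (fpsX ^+ (l + r) * iter l (@fpsD R[i]) f)) /\
  (forall m r : nat, (r <= m)%N ->
     op_dfall (@xD R[i]) lam%:C (m - r) (fpsX ^+ r * iter r (@fpsD R[i]) f) =
     \sum_(r <= l < m.+1)
        rstirling2 r lam%:C m l *: (fpsX ^+ l * iter l (@fpsD R[i]) f)).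
Proof.
split=> [m r|m r le_rm]; rewrite op_dfall_xD_fpsXnM //.
(* Shifting [l] by [r] makes the two ranges equal; then [D^(l+r) f = D^l (D^r f)]. *)
rewrite [RHS](big_addn 0 m.+1 r) subSn // subnK //.
by apply: eq_bigr => l _; rewrite iterD.
Qed.
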